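(* Let $X:M \to \mathbb{R}^3_1$ be a proper conformal maximal immersion of a Riemann surface $M$ with $\partial(M) \neq \emptyset$. Suppose that for some $\alpha\in\,]0,\pi/4[$ the surface $X(M)$ eventually lies in the conical region $$W_\alpha=\{(x,x_3)\in\mathbb{C}\times\mathbb{R}\equiv\mathbb{R}^3 \;:\; |x_3|\le |x|\tan(\alpha)\},$$ that is, $X(p)\in W_\alpha$ for all $p$ outside some compact subset of $M$. Then $M$ is relative parabolic.
   Context: $\mathbb{R}^3_1$ denotes the Lorentz-Minkowski space: $\mathbb{R}^3$ with the metric $\langle\,,\rangle = dx_1^2+dx_2^2-dx_3^2$. The plane $\{x_3=0\}$ is identified with $\mathbb{C}$, and $|x|$ is the Euclidean norm of $x\in\mathbb{C}$. Surfaces with boundary. Riemann surfaces are connected. A Riemann surface $M$ with $\partial(M)\neq\emptyset$ is assumed to satisfy $M\subseteq M'$ for an open Riemann surface $M'$; $\partial(M)\subset M$ is the topological frontier of $M$ in $M'$ and consists of a proper (without accumulation) family of pairwise disjoint closed curves in $M'$, at least piecewise $\mathcal{C}^1$ (closed as subsets of $M'$), some of which may be degenerate, i.e. isolated points. $\mathrm{Int}(M)=M-\partial(M)$. Maps on $M$ are called smooth (conformal, harmonic, meromorphic, ...) if they are restrictions of such maps on $M'$. Maximal immersions. A smooth map $X:M\to\mathbb{R}^3_1$ is spacelike if the metric induced from $\langle\,,\rangle$ is Riemannian at every point of $\mathrm{Int}(M)$. A conformal map $X:M\to\mathbb{R}^3_1$ is a (conformal) maximal immersion if it is spacelike and $X|_{\mathrm{Int}(M)}$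 has zero mean curvature. The tangent plane at points of $\partial(M)$ is allowed to be non-Riemannian (singular boundary points). The Weierstrass data of $X$ are assumed to extend meromorphically beyond $\partial(M)$. Relative parabolicity. A Riemann surface $R$ with $\partial(R)\neq\emptyset$ is relative parabolic if the only bounded harmonic function $f$ on $R$ vanishing on $\partial(R)$ is $f=0$. *)

(* Defs.v *)
From HB Require Import structures.
From mathcomp Require Import all_boot all_order all_algebra.
From mathcomp Require Import all_classical all_reals all_analysis.
From mathcomp Require Import complex.

Set Implicit Arguments.
Unset Strict Implicit.
Unset Printing Implicit Defensive.

Import Order.TTheory GRing.Theory Num.Theory.
Import numFieldTopology.Exports numFieldNormedType.Exports.

Local Open Scope classical_set_scope.
Local Open Scope ring_scope.

(* The complex plane is [R[i]^o], i.e. [R[i]] with the topology given by its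
   modulus and seen as a normed space over itself; [derivable f z 1] is then
   complex differentiability at [z].  Real partial derivatives are taken on
   [R * R], identified with the plane through [cplx]. *)
Notation Cplane R := (R[i]^o).

Definition cplx (R : realType) (u : R * R) : Cplane R := (u.1 +i* u.2)%C.

Section Plane.
Variable R : realType.

Definition holomorphic_on (A : set (Cplane R)) (h : Cplane R -> Cplane R) :=
  forall z, A z -> derivable h z 1.

Definition meromorphic_at (h : Cplane R -> Cplane R) (z : Cplane R) :=
  exists (n : nat) (k : Cplane R -> Cplane R),
    (\forall w \near z, derivable k w 1) /\
    (\forall w \near z^', h w * (w - z) ^+ n = k w).

(* The Riemann sphere, [None] being the point at infinity. *)
Definition sphere := one_point_compactification (Cplane R).

Definition sphere_inv (s : sphere) : sphere :=
  match s with
  | None => Some (0 : Cplane R)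
  | Some w => if w == 0 then None else Some w^-1
  end.

(* Holomorphy as a map to the sphere; the constant [None] is included. *)
Definition sphere_holomorphic_at (h : Cplane R -> sphere) (z : Cplane R) :=
  exists k : Cplane R -> Cplane R,
    (\forall w \near z, derivable k w 1) /\
    ((\forall w \near z, h w = Some (k w)) \/
     (\forall w \near z, h w = sphere_inv (Some (k w)))).

Definition pd1 (V : normedModType R) (f : R * R -> V) : R * R -> V :=
  'D_(1, 0) f.
Definition pd2 (V : normedModType R) (f : R * R -> V) : R * R -> V :=
  'D_(0, 1) f.

Fixpoint Ck (V : normedModType R) (n : nat) (A : set (R * R))
    (f : R * R -> V) : Prop :=
  (forall u, A u -> {for u, continuous f}) /\
  if n is n'.+1 then
    [/\ forall u, A u -> derivable f u (1, 0) /\ derivable f u (0, 1),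
        Ck n' A (pd1 f) & Ck n' A (pd2 f)]
  else True.

End Plane.

Section RiemannSurface.
Variables (R : realType) (T : topologicalType).

Record chart := Chart {
  dom : set T;
  coord :> T -> Cplane R;
  param : Cplane R -> T;
  dom_open : open dom;
  img_open : open (coord @` dom);
  coordK : forall p, dom p -> param (coord p) = p;
  coord_continuous : {within dom, continuous coord};
  param_continuous : {within coord @` dom, continuous param}
}.

(* Second countability is not required: it is automatic (Rado). *)
Record riemann_surface := RiemannSurface {
  atlas : set chart;
  surface_hausdorff : hausdorff_space T;
  surface_connected : connected [set: T];
  atlas_cover : forall p : T, exists2 c, atlas c & dom c p;
  atlas_compat : forall c d, atlas c -> atlas d ->
    holomorphic_on (c @` (dom c `&` dom d)) (d \o param c)
}.

Variable S : riemann_surface.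

Definition open_surface := ~ compact [set: T].

Definition local (c : chart) (V : Type) (f : T -> V) : R * R -> V :=
  fun u => f (param c (cplx u)).

Definition local_set (c : chart) (A : set T) : set (R * R) :=
  [set u | exists2 p, (dom c `&` A) p & c p = cplx u].

(* The following are used for open [A]. *)
Definition smooth_on (V : normedModType R) (A : set T) (f : T -> V) :=
  forall c, atlas S c -> forall n, Ck n (local_set c A) (local c f).

Definition harmonic_on (A : set T) (f : T -> R) :=
  forall c, atlas S c ->
    Ck 2 (local_set c A) (local c f) /\
    forall u, local_set c A u ->
      pd1 (pd1 (local c f)) u + pd2 (pd2 (local c f)) u = 0.

Definition frontier (A : set T) : set T := closure A `\` A°.

Definition C1_regular_at (s : R -> R * R) (t : R) :=
  \forall x \near t, [/\ derivable s x 1, {for x, continuous ('D_1 s)} &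
                         'D_1 s x != 0].

(* Around each parameter [t] the curve is, on each side of [t] and up to [t],
   a regular C^1 arc; the corners are thus locally finite. *)
Definition piecewise_C1 (gam : R -> T) :=
  forall t, exists c sl sr,
    [/\ atlas S c, C1_regular_at sl t, C1_regular_at sr t,
        \forall x \near t, x <= t ->
          dom c (gam x) /\ c (gam x) = cplx (sl x) &
        \forall x \near t, t <= x ->
          dom c (gam x) /\ c (gam x) = cplx (sr x)].

Definition injective_mod1 (gam : R -> T) :=
  forall s t, gam s = gam t <-> exists k : int, t = s + k%:~R.

(* A simple piecewise C^1 arc without endpoints, or a Jordan curve. *)
Definition curve (E : set T) :=
  exists gam : R -> T,
    [/\ piecewise_C1 gam, injective gam \/ injective_mod1 gam &
        E = range gam].

(* [M] is a (closed) subsurface with boundary [B].  [B] consists of the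
   topological frontier of [M] and, possibly, of degenerate curves.  A
   degenerate curve is an isolated point of [B]; being surrounded by points of
   [M `\` B] it lies in the frontier of [M `\` B] but not in that of [M], and
   hence [B] is only required to contain the latter, up to such points. *)
Record bordered (M B : set T) : Prop := Bordered {
  bordered_closed : closed M;
  bordered_connected : connected M;
  bordered_dense : M `<=` closure (M `\` B);
  bordered_frontier : frontier M `<=` B;
  bordered_sub : B `<=` M;
  bordered_curves : exists F : set (set T),
    [/\ B = \bigcup_(E in F) E,
        trivIset F id,
        forall p : T, exists2 U, nbhs p U &
          finite_set [set E | F E /\ E `&` U !=set0] &
        forall E, F E -> closed E /\
          ((exists p, E = [set p]) \/ (curve E /\ E `<=` frontier M))]
}.

Definition relative_parabolic (M B : set T) :=
  forall f : T -> R,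
    {within M, continuous f} -> harmonic_on (M `\` B) f ->
    (exists k, forall p, M p -> `|f p| <= k) ->
    (forall p, B p -> f p = 0) ->
    forall p, M p -> f p = 0.

End RiemannSurface.

Section Lorentz.
Variable R : realType.
Local Notation R3 := 'rV[R]_3.

Definition x1 (v : R3) : R := v 0 0.
Definition x2 (v : R3) : R := v 0 1.
Definition x3 (v : R3) : R := v 0 2.

Definition vec3 (a b c : R) : R3 := \row_i [:: a; b; c]`_i.

Definition lorentz (v w : R3) : R := x1 v * x1 w + x2 v * x2 w - x3 v * x3 w.

(* Characterized by [lorentz (lcross v w) z] being the determinant of
   [v, w, z]. *)
Definition lcross (v w : R3) : R3 :=
  vec3 (x2 v * x3 w - x3 v * x2 w) (x3 v * x1 w - x1 v * x3 w)
       (x2 v * x1 w - x1 v * x2 w).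

Definition cone (alpha : R) : set R3 :=
  [set v | `|x3 v| <= Num.sqrt (x1 v ^+ 2 + x2 v ^+ 2) * tan alpha].

Section Patch.
Variable Y : R * R -> R3.

Definition ffE u := lorentz (pd1 Y u) (pd1 Y u).
Definition ffF u := lorentz (pd1 Y u) (pd2 Y u).
Definition ffG u := lorentz (pd2 Y u) (pd2 Y u).

Definition conformal_at u := ffE u = ffG u /\ ffF u = 0.

Definition spacelike_at u :=
  forall a b : R, (a, b) != (0, 0) ->
    0 < lorentz (a *: pd1 Y u + b *: pd2 Y u) (a *: pd1 Y u + b *: pd2 Y u).

(* The normal of a spacelike patch is timelike. *)
Definition unit_normal u : R3 :=
  let n := lcross (pd1 Y u) (pd2 Y u) in
  (Num.sqrt (- lorentz n n))^-1 *: n.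

Definition mean_curvature u : R :=
  let N := unit_normal u in
  let e := lorentz (pd1 (pd1 Y) u) N in
  let f := lorentz (pd2 (pd1 Y) u) N in
  let g := lorentz (pd2 (pd2 Y) u) N in
  (e * ffG u - 2 * f * ffF u + g * ffE u) /
  (2 * (ffE u * ffG u - ffF u ^+ 2)).

End Patch.
End Lorentz.

Section Maximal.
Variables (R : realType) (T : topologicalType) (S : riemann_surface R T).
Local Notation R3 := 'rV[R]_3.

(* The values of [X] outside [M] are irrelevant.  Conformality does not exclude
   points where the induced metric vanishes. *)
Definition conformal_map (M : set T) (X : T -> R3) :=
  exists Y : T -> R3,
    [/\ smooth_on S setT Y,
        forall c, atlas S c -> forall u, local_set c setT u ->
          conformal_at (local c Y) u &
        forall p, M p -> X p = Y p].

Definition spacelike (M B : set T) (X : T -> R3) :=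
  forall c, atlas S c -> forall u, local_set c (M `\` B) u ->
    spacelike_at (local c X) u.

Definition zero_mean_curvature (M B : set T) (X : T -> R3) :=
  forall c, atlas S c -> forall u, local_set c (M `\` B) u ->
    mean_curvature (local c X) u = 0.

Definition conformal_maximal_immersion (M B : set T) (X : T -> R3) :=
  [/\ conformal_map M X, spacelike M B X & zero_mean_curvature M B X].

(* The coefficient of [2 * dx/dz] in the chart [c], for a coordinate [x] of
   [X]; thus [X = Re (int (phi1, phi2, phi3))]. *)
Definition weierstrass_phi (c : chart R T) (x : R3 -> R) (X : T -> R3)
    (u : R * R) : Cplane R :=
  cplx (x (pd1 (local c X) u), - x (pd2 (local c X) u)).

(* [phi1 = (i/2) (1/g - g) phi3] and [phi2 = (-1/2) (1/g + g) phi3], written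
   without division so as to make sense at the zeros and poles of [g]. *)
Definition weierstrass_relation (g : sphere R) (f1 f2 f3 : Cplane R) :=
  let i : Cplane R := cplx (0, 1) in
  match g with
  | Some w => w * (f1 - i * f2) = i * f3 /\ f1 + i * f2 = - i * w * f3
  | None => f1 - i * f2 = 0 /\ f3 = 0
  end.

(* [omega c] is the coefficient of a meromorphic 1-form in the chart [c]; its
   values at the poles are irrelevant. *)
Definition meromorphic_form_on (U : set T)
    (omega : chart R T -> T -> Cplane R) :=
  (forall c, atlas S c -> forall p, (dom c `&` U) p ->
     meromorphic_at (omega c \o param c) (c p)) /\
  (forall c d, atlas S c -> atlas S d ->
     forall p, (dom c `&` dom d `&` U) p -> \forall q \near p^',
       omega c q = omega d q * 'D_1 (d \o param c : Cplane R -> Cplane R) (c q)).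

(* The Weierstrass data [(g, phi3)] of [X] on the interior of [M] extend
   meromorphically to a neighbourhood of [M]. *)
Definition weierstrass_data_extend (M B : set T) (X : T -> R3) :=
  exists (U : set T) (g : T -> sphere R) (omega : chart R T -> T -> Cplane R),
    [/\ open U, M `<=` U,
        forall c, atlas S c -> forall p, (dom c `&` U) p ->
          sphere_holomorphic_at (g \o param c) (c p),
        meromorphic_form_on U omega &
        forall c, atlas S c -> forall p u, (dom c `&` (M `\` B)) p ->
          c p = cplx u ->
          let phi x := weierstrass_phi c x X u in
          omega c p = phi (@x3 R) /\
          weierstrass_relation (g p) (phi (@x1 R)) (phi (@x2 R)) (phi (@x3 R))].

Definition proper_on (M : set T) (X : T -> R3) :=
  forall K : set R3, compact K -> compact (M `&` X @^-1` K).

Definition eventually_in (M : set T) (X : T -> R3) (W : set R3) :=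
  exists K : set T, [/\ compact K, K `<=` M &
    forall p, (M `\` K) p -> W (X p)].

End Maximal.

(* Main.v *)
Require Import Defs.
From mathcomp Require Import all_boot all_order all_algebra.
From mathcomp Require Import all_classical all_reals all_analysis.
From mathcomp Require Import complex.
From mathcomp Require Import ring lra.

Set Implicit Arguments.
Unset Strict Implicit.
Unset Printing Implicit Defensive.

Import Order.TTheory GRing.Theory Num.Theory.
Import numFieldTopology.Exports numFieldNormedType.Exports.

Local Open Scope classical_set_scope.
Local Open Scope ring_scope.

(** The coordinates of a conformal maximal immersion are harmonic functions, so
    in a conformal parameter its Laplacian is elementary to compute.  Where the
    Lorentzian square [r = <X, X>] is larger than [1], the function
    [u = ln (r - 1)] is strictly superharmonic: with [E] the conformal factor,
    the Laplacian of [r] is [4 E], while the squared gradient of [r] is at least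
    [4 E r], because the normal part of [X] is timelike
    ([lorentz_tangential], [ln_lorentz_superharmonic]).  In the cone, whose
    angle is below [pi / 4], [r] is bounded below by a multiple of the Euclidean
    square ([cone_lorentz]); [X] being proper, [u] is therefore defined,
    nonnegative and proper outside a compact subset of [M].

    Such a function forces relative parabolicity
    ([relative_parabolic_of_superharmonic]).  Let [f] be harmonic, bounded, and
    zero on the boundary.  For each [d > 0] the function [f - d u] is strictly
    subharmonic near infinity and is nonpositive far away, so that it is bounded by
    its values on the boundary and on a compact set; letting [d] tend to zero,
    [f] is bounded by the larger of [0] and its maximum on a compact set
    ([maximum_at_infinity]).  If that maximum [m] were positive, the set where
    [f = m] would be closed, would miss the boundary, and would be open by the
    strong maximum principle; as [M] is connected it would be all of [M], which
    is absurd since the boundary is not empty ([harmonic_le0]).  Of the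
    boundary, this argument only uses that it is a closed part of [M] containing
    the frontier of [M]; the regularity of its curves plays no role.

    Both maximum principles are derived from the second derivative test; the
    strong one rests on Hopf's barrier ([strong_maximum_plane]), here a quadratic
    polynomial.  Harmonicity of the coordinates follows from conformality, which
    makes the Laplacian of [X] orthogonal to both partial derivatives by the
    symmetry of mixed derivatives ([schwarz]), and from the vanishing of the mean
    curvature, which makes it orthogonal to the normal. *)

(** * Second derivatives at a maximum *)

Section SecondDerivative.
Variable R : realType.

Lemma is_derive_line (V W : normedModType R) (f : V -> W) (x v : V) (t : R)
    (d : W) :
  is_derive (t *: v + x) v f d <-> is_derive t 1 (fun h => f (h *: v + x)) d.
Proof.
have E : (fun h : R => h^-1 *: ((f \o shift (t *: v + x)) (h *: v)
                                - f (t *: v + x))) =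
         (fun h : R => h^-1 *: (((fun h => f (h *: v + x)) \o shift t) (h *: 1)
                                - f (t *: v + x))).
  by apply/funext => h /=; rewrite addrA -scalerDl [h *: 1]mulr1.
by split=> -[dv <-]; split; rewrite /derivable/derive /= ?E // -?E.
Qed.

(** The second derivative test: a positive second derivative makes the first one
    positive on the right of the maximum, contradicting the mean value theorem. *)
Lemma second_derivative_le0 (g g1 : R -> R) (d : R) :
  (\forall t \near (0 : R), is_derive t (1 : R) g (g1 t)) -> is_derive (0 : R) 1 g1 d ->
  (\forall t \near (0 : R), g t <= g 0) -> d <= 0.
Proof.
move=> dg dg1 gmax; rewrite leNgt; apply/negP => d0.
have /nbhs_ballP[e /= e0 ge0] : \forall t \near (0 : R),
  is_derive t (1 : R) g (g1 t) /\ g t <= g 0 by near do split.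
have ge t : `|t| < e -> is_derive t (1 : R) g (g1 t) /\ g t <= g 0.
  by move=> te; apply: ge0; rewrite /ball /= sub0r normrN.
have ite t : t \in `]-e, e[%R -> `|t| < e by rewrite in_itv /= ltr_norml.
have g10 : g1 0 = 0.
  have D : is_derive (0 : R) 1 g 0.
    apply: (@derive1_at_max _ _ (-e) e); first by rewrite ge0_cp // ltW.
    - by move=> t /ite /ge[[]].
    - by rewrite in_itv /= oppr_lt0 e0.
    - by move=> t /ite /ge[].
  have [D' _] : is_derive (0 : R) 1 g (g1 0) /\ g 0 <= g 0.
    by apply: ge; rewrite normr0.
  by rewrite -(@derive_val _ _ _ _ _ _ _ D') (@derive_val _ _ _ _ _ _ _ D).
have /cvgrPdist_lt /(_ _ d0) : h^-1 *: (g1 h) @[h --> 0^'] --> d.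
  case: dg1 => dg1 <-; apply: cvg_trans dg1.
  apply: near_eq_cvg; near=> h; rewrite /= addr0 g10 subr0.
  by rewrite [h%:A]mulr1.
rewrite /= near_withinE => /nbhs_ballP[r /= r0 gr].
pose s := Num.min e r / 2.
have m0 : 0 < Num.min e r by rewrite lt_min e0.
have s0 : 0 < s by rewrite divr_gt0.
have sm : s < Num.min e r by rewrite gtr_pMr// invf_lt1// ltr1n.
have /andP[se sr] : (s < e) && (s < r) by rewrite -lt_min.
have pos t : 0 < t -> t <= s -> 0 < g1 t.
  move=> t0 ts; have := gr t; rewrite /ball /= sub0r normrN gtr0_norm //.
  move=> /(_ (le_lt_trans ts sr)) /(_ (lt0r_neq0 t0)).
  rewrite ltr_distlC => /andP[+ _]; rewrite subrr.
  by rewrite pmulr_rgt0// invr_gt0.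
have [||c] := @MVT _ g g1 0 s s0.
- move=> x; rewrite in_itv /= => /andP[x0 xs].
  by have [|] := ge x; rewrite // gtr0_norm// (lt_trans xs).
- apply: derivable_within_continuous => x; rewrite in_itv /= => /andP[x0 xs].
  have [|[]//] := ge x.
  by rewrite ger0_norm// (le_lt_trans xs).
rewrite in_itv /= subr0 => /andP[c0 cs] E.
have [|_] := ge s; first by rewrite gtr0_norm.
apply/negP; rewrite -ltNge -subr_gt0 E mulr_gt0// pos//; exact: ltW.
Unshelve. all: by end_near. Qed.

(** [has_second f u v d]: near [u] the function [f] has a derivative in the
    direction [v], whose own derivative along [v] at [u] is [d]. *)
Definition has_second (f : R * R -> R) (u v : R * R) (d : R) :=
  exists2 f1 : R * R -> R,
    \forall w \near u, is_derive w v f (f1 w) & is_derive u v f1 d.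

(** [has_laplacian f u l]: both pure second derivatives of [f] exist at [u], and
    [l] is their sum.  Continuity of the derivatives is not part of it, as the
    second derivative test along the two axes does not need it. *)
Definition has_laplacian (f : R * R -> R) (u : R * R) (l : R) :=
  exists d1 d2, [/\ has_second f u (1, 0) d1, has_second f u (0, 1) d2 &
                    l = d1 + d2].

Lemma has_second_le0 f u v d :
  has_second f u v d -> (\forall w \near u, f w <= f u) -> d <= 0.
Proof.
move=> [f1 df df1] fmax.
have line : (h *: v + u) @[h --> (0 : R)] --> u.
  rewrite -[X in _ --> X]add0r -(scale0r v).
  by apply: cvgD; [apply: cvgZr_tmp; exact: cvg_id | exact: cvg_cst].
apply: (@second_derivative_le0 (fun h => f (h *: v + u))
  (fun h => f1 (h *: v + u))).
- have H : \forall t \near (0 : R), is_derive (t *: v + u) v f (f1 (t *: v + u)).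
    exact: line df.
  near=> t; apply: (is_derive_line f u v t _).1; exact: (near H t).
- by apply: (is_derive_line f1 u v 0 _).1; rewrite scale0r add0r.
- have H : \forall t \near (0 : R), f (t *: v + u) <= f u by exact: line fmax.
  by near=> t; rewrite scale0r add0r; apply: (near H t).
Unshelve. all: by end_near. Qed.

Lemma has_laplacian_le0 f u l :
  has_laplacian f u l -> (\forall w \near u, f w <= f u) -> l <= 0.
Proof.
move=> [d1 [d2 [H1 H2 ->]]] fmax.
by rewrite -[0]addr0 lerD//; [apply: has_second_le0 H1 _ | apply: has_second_le0 H2 _].
Qed.

Lemma has_secondD f g u v a b : has_second f u v a -> has_second g u v b ->
  has_second (f \+ g) u v (a + b).
Proof.
move=> [f1 df df1] [g1 dg dg1]; exists (f1 \+ g1); last exact: is_deriveD.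
by near do apply: is_deriveD.
Unshelve. all: by end_near. Qed.

Lemma has_secondZ f u v a k : has_second f u v a ->
  has_second (fun w => k * f w) u v (k * a).
Proof.
move=> [f1 df df1]; exists (fun w => k * f1 w); last exact: is_deriveZ.
by near do apply: is_deriveZ.
Unshelve. all: by end_near. Qed.

Lemma has_laplacianD f g u a b : has_laplacian f u a -> has_laplacian g u b ->
  has_laplacian (f \+ g) u (a + b).
Proof.
move=> [a1 [a2 [A1 A2 ->]]] [b1 [b2 [B1 B2 ->]]].
exists (a1 + b1), (a2 + b2); rewrite addrACA.
by split=> //; exact: has_secondD.
Qed.

Lemma has_laplacianZ f u a k : has_laplacian f u a ->
  has_laplacian (fun w => k * f w) u (k * a).
Proof.
move=> [a1 [a2 [A1 A2 ->]]]; exists (k * a1), (k * a2); rewrite mulrDr.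
by split=> //; exact: has_secondZ.
Qed.

Lemma near_eq_has_second (f g : R * R -> R) u v d :
  (\forall w \near u, f w = g w) -> has_second f u v d -> has_second g u v d.
Proof.
move=> /near_join fg [f1 df df1]; exists f1 => //.
near=> w; apply: (@near_eq_is_derive _ _ _ f g); first by near: w.
by near: w.
Unshelve. all: by end_near. Qed.

Lemma near_eq_has_laplacian (f g : R * R -> R) u l :
  (\forall w \near u, f w = g w) -> has_laplacian f u l -> has_laplacian g u l.
Proof.
move=> fg [d1 [d2 [H1 H2 E]]]; exists d1, d2.
by split=> //; exact: near_eq_has_second fg _.
Qed.

End SecondDerivative.

(** * Calculus in the plane *)

Section Calculus.
Variable R : realType.

Lemma is_derive_comp_ln (f : R * R -> R) (u v : R * R) (a : R) :
  1 < f u -> is_derive u v f a ->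
  is_derive u v (fun w => ln (f w - 1)) ((f u - 1)^-1 * a).
Proof.
move=> fu df; rewrite -[u in is_derive u](add0r u) -(scale0r v).
apply: (is_derive_line (fun w => ln (f w - 1)) u v 0 _).2.
apply: (@is_derive1_comp _ (fun x => ln (x - 1)) (fun h => f (h *: v + u))).
  rewrite scale0r add0r -[(f u - 1)^-1]mulr1.
  apply: (@is_derive1_comp _ (@ln R) (fun x => x - 1)).
    by apply: is_derive1_ln; rewrite subr_gt0.
  by apply: is_derive_eq; rewrite subr0.
by apply: (is_derive_line f u v 0 _).1; rewrite scale0r add0r.
Qed.

Lemma has_second_ln (f f1 : R * R -> R) (u v : R * R) (d : R) :
  1 < f u -> {for u, continuous f} ->
  (\forall w \near u, is_derive w v f (f1 w)) -> is_derive u v f1 d ->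
  has_second (fun w => ln (f w - 1)) u v
    (d / (f u - 1) - f1 u ^+ 2 / (f u - 1) ^+ 2).
Proof.
move=> fu cf df df1.
have fgt : \forall w \near u, 1 < f w.
  by apply: (cf [set x | 1 < x]); apply: open_nbhs_nbhs; split=> //; exact: open_gt.
have f10 : f u - 1 != 0 by rewrite subr_eq0 gt_eqF.
exists (fun w => (f w - 1)^-1 * f1 w).
  by near=> w; apply: is_derive_comp_ln; near: w.
have duf : is_derive u v f (f1 u) by exact: nbhs_singleton df.
have dV : is_derive u v (fun w => (f w - 1)^-1) (- (f u - 1) ^- 2 *: f1 u).
  have dB : is_derive u v (fun w => f w - 1) (f1 u).
    by apply: is_derive_eq; rewrite subr0.
  split; first by apply: (@derivableV _ _ (fun w => f w - 1)); case: dB.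
  by case: dB => dB <-; rewrite -(@deriveV _ _ (fun w => f w - 1)).
apply: is_derive_eq.
by rewrite /GRing.scale /=; field.
Unshelve. all: by end_near. Qed.

(** Iterating the mean value theorem: [f12] is the derivative along [w] of the
    derivative along [v].  The left-hand side is symmetric in [v] and [w]. *)
Lemma second_difference (V : normedModType R) (f f1 f12 : V -> R) (u v w : V)
    (e h : R) :
  (forall x, ball u e x -> is_derive x v f (f1 x)) ->
  (forall x, ball u e x -> is_derive x w f1 (f12 x)) ->
  0 < h -> h * (`|v| + `|w|) < e ->
  exists2 x, ball u e x &
    f (h *: v + (h *: w + u)) - f (h *: v + u) - f (h *: w + u) + f u
    = h ^+ 2 * f12 x.
Proof.
move=> df df1 h0 he.
have bal s t : 0 <= s -> s <= h -> 0 <= t -> t <= h ->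
    ball u e (s *: v + (t *: w + u)).
  move=> s0 sh t0 th; rewrite -ball_normE /ball_ /= distrC addrA addrK.
  apply: le_lt_trans he; rewrite (le_trans (ler_normD _ _))// !normrZ !ger0_norm//.
  by rewrite mulrDr lerD// ler_wpM2r.
pose g s := f (s *: v + (h *: w + u)) - f (s *: v + u).
pose g1 s := f1 (s *: v + (h *: w + u)) - f1 (s *: v + u).
have dg s : 0 <= s -> s <= h -> is_derive s (1 : R) g (g1 s).
  move=> s0 sh; apply: is_deriveB.
    by apply: (is_derive_line f _ v s _).1; apply/df/bal => //; exact: ltW.
  apply: (is_derive_line f _ v s _).1; apply: df.
  by have := bal s 0 s0 sh (lexx _) (ltW h0); rewrite scale0r add0r.
have [||c] := @MVT _ g g1 0 h h0.
- by move=> s; rewrite in_itv /= => /andP[s0 sh]; apply: dg; exact: ltW.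
- apply: derivable_within_continuous => s; rewrite in_itv /= => /andP[s0 sh].
  by have [] := dg s s0 sh.
rewrite in_itv /= => /andP[/ltW c0 /ltW ch].
rewrite subr0 {1 2}/g !scale0r !add0r => Dg.
pose k t := f1 (t *: w + (c *: v + u)).
have dk t : 0 <= t -> t <= h ->
    is_derive t (1 : R) k (f12 (t *: w + (c *: v + u))).
  move=> t0 th; apply: (is_derive_line f1 _ w t _).1; apply: df1.
  by rewrite addrCA; exact: bal.
have [||d] := @MVT _ k (fun t => f12 (t *: w + (c *: v + u))) 0 h h0.
- by move=> s; rewrite in_itv /= => /andP[s0 sh]; apply: dk; exact: ltW.
- apply: derivable_within_continuous => s; rewrite in_itv /= => /andP[s0 sh].
  by have [] := dk s s0 sh.
rewrite in_itv /= => /andP[/ltW d0 /ltW dh].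
rewrite subr0 /k scale0r add0r => Dk.
exists (d *: w + (c *: v + u)); first by rewrite addrCA; exact: bal.
rewrite expr2 -mulrA [h * f12 _]mulrC -Dk [h * _]mulrC.
rewrite [h *: w + (c *: v + u)]addrCA -/(g1 c) -Dg.
by ring.
Qed.

(** Symmetry of the mixed second derivatives. *)
Lemma schwarz (V : normedModType R) (f f1 f2 f12 f21 : V -> R) (u v w : V) :
  (\forall x \near u, is_derive x v f (f1 x)) ->
  (\forall x \near u, is_derive x w f (f2 x)) ->
  (\forall x \near u, is_derive x w f1 (f12 x)) ->
  (\forall x \near u, is_derive x v f2 (f21 x)) ->
  {for u, continuous f12} -> {for u, continuous f21} -> f12 u = f21 u.
Proof.
move=> d1 d2 d12 d21 c12 c21.
apply/eqP; rewrite -subr_eq0 -normr_le0; apply/ler_addgt0Pr => e e0.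
rewrite add0r.
have e20 : 0 < e / 2 by rewrite divr_gt0.
have /nbhs_ballP[r /= r0 H] : \forall x \near u,
    [/\ is_derive x v f (f1 x), is_derive x w f (f2 x),
        is_derive x w f1 (f12 x), is_derive x v f2 (f21 x) &
        `|f12 u - f12 x| < e / 2 /\ `|f21 u - f21 x| < e / 2].
  move/cvgrPdist_lt : c12 => /(_ _ e20) c12.
  move/cvgrPdist_lt : c21 => /(_ _ e20) c21.
  by near=> x; split; [near: x|near: x|near: x|near: x|split; near: x].
pose h := r / (`|v| + `|w| + 1).
have n0 : 0 < `|v| + `|w| + 1 by rewrite ltr_wpDl.
have h0 : 0 < h by rewrite divr_gt0.
have hr : h * (`|v| + `|w|) < r.
  by rewrite /h mulrAC ltr_pdivrMr// ltr_pM2l// ltrDl.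
have [x bx Ex] : exists2 x, ball u r x &
  f (h *: v + (h *: w + u)) - f (h *: v + u) - f (h *: w + u) + f u
    = h ^+ 2 * f12 x.
  by apply: (@second_difference _ f f1) => // x /H[].
have [x' bx' Ex'] : exists2 x, ball u r x &
  f (h *: w + (h *: v + u)) - f (h *: w + u) - f (h *: v + u) + f u
    = h ^+ 2 * f21 x.
  by apply: (@second_difference _ f f2); rewrite 1?addrC// => x0 /H[].
have E : f12 x = f21 x'.
  have h20 : h ^+ 2 != 0 by rewrite expf_neq0// gt_eqF.
  apply: (mulfI h20); rewrite -Ex -Ex' addrCA.
  by congr (_ + _); rewrite addrAC.
have [_ _ _ _ [A _]] := H _ bx; have [_ _ _ _ [_ B]] := H _ bx'.
rewrite (_ : f12 u - f21 u = (f12 u - f12 x) - (f21 u - f21 x')); last first.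
  by rewrite E opprB addrA subrK.
by rewrite (le_trans (ler_normB _ _))// (splitr e) lerD// ltW.
Unshelve. all: by end_near. Qed.

Lemma is_derive_coord m n (Y : R * R -> 'M[R]_(m, n)) (u v : R * R) i j :
  derivable Y u v -> is_derive u v (fun w => Y w i j) ('D_v Y u i j).
Proof.
move=> dY; split; first by move/derivable_mxP : dY.
by rewrite derive_mx// mxE.
Qed.

End Calculus.

(** * Lorentzian algebra and maximal patches *)

Section LorentzAlgebra.
Variable R : realType.
Implicit Types p q v w : 'rV[R]_3.

Lemma lorentzC v w : lorentz v w = lorentz w v.
Proof. by rewrite /lorentz; ring. Qed.

Lemma lorentzDl v v' w : lorentz (v + v') w = lorentz v w + lorentz v' w.
Proof. by rewrite /lorentz /x1 /x2 /x3 !mxE; ring. Qed.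

Lemma lorentzZr a v w : lorentz v (a *: w) = a * lorentz v w.
Proof. by rewrite /lorentz /x1 /x2 /x3 !mxE; ring. Qed.

(** The Gram determinant of [(v, p, q)] against [(w, p, q)]: the cross product
    being a determinant, it is minus the product of two determinants. *)
Lemma lorentz_gram p q v w :
  lorentz (lcross p q) v * lorentz (lcross p q) w =
  - (lorentz v w * (lorentz p p * lorentz q q - lorentz p q ^+ 2)
     - lorentz v p * (lorentz w p * lorentz q q - lorentz w q * lorentz p q)
     + lorentz v q * (lorentz w p * lorentz p q - lorentz w q * lorentz p p)).
Proof. by rewrite /lorentz /lcross /vec3 /x1 /x2 /x3 !mxE /=; ring. Qed.

Lemma lorentz_lcross p q :
  lorentz (lcross p q) (lcross p q) =
  - (lorentz p p * lorentz q q - lorentz p q ^+ 2).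
Proof. by rewrite /lorentz /lcross /vec3 /x1 /x2 /x3 !mxE /=; ring. Qed.

(** The mean curvature as a function of the first derivatives [p, q] and the
    second derivatives [a, b, c] of a patch. *)
Definition curvature_of (p q a b c : 'rV[R]_3) :=
  let n := lcross p q in let N := (Num.sqrt (- lorentz n n))^-1 *: n in
  (lorentz a N * lorentz q q - 2 * lorentz b N * lorentz p q
   + lorentz c N * lorentz p p) /
  (2 * (lorentz p p * lorentz q q - lorentz p q ^+ 2)).

Section ConformalFrame.
Variables (p q : 'rV[R]_3) (l : R).
Hypotheses (pp : lorentz p p = l) (qq : lorentz q q = l).
Hypotheses (pq : lorentz p q = 0) (l_gt0 : 0 < l).

Lemma lorentz_orthogonal v w : lorentz w p = 0 -> lorentz w q = 0 ->
  lorentz (lcross p q) w = 0 -> lorentz v w = 0.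
Proof.
move=> wp wq wn; have := lorentz_gram p q v w.
rewrite pp qq pq wp wq wn => /eqP; rewrite !(mulr0, mul0r, subr0, addr0).
rewrite expr0n /= subr0 eq_sym oppr_eq0 !mulf_eq0 orbb.
by rewrite (gt_eqF l_gt0) orbF => /eqP.
Qed.

(** The normal component of [v] is timelike, so the square of [v] is at most
    that of its tangential component. *)
Lemma lorentz_tangential v :
  l * lorentz v v <= lorentz v p ^+ 2 + lorentz v q ^+ 2.
Proof.
have := lorentz_gram p q v v; rewrite pp qq pq => E.
have : 0 <= lorentz (lcross p q) v * lorentz (lcross p q) v.
  by rewrite -expr2 sqr_ge0.
rewrite E (_ : - _ = l *
  (lorentz v p ^+ 2 + lorentz v q ^+ 2 - l * lorentz v v)); last by ring.
by rewrite (pmulr_rge0 _ l_gt0) subr_ge0.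
Qed.

Lemma curvature_of_eq0 a b c : curvature_of p q a b c = 0 ->
  lorentz (lcross p q) (a + c) = 0.
Proof.
rewrite /curvature_of pp qq pq; set n := lcross _ _.
have nn : 0 < Num.sqrt (- lorentz n n).
  rewrite sqrtr_gt0 lorentz_lcross pp qq pq opprK expr0n /= subr0.
  by rewrite mulr_gt0.
rewrite mulr0 subr0 expr0n /= subr0.
rewrite -mulrDl !lorentzZr -mulrDr -lorentzDl => /eqP.
rewrite !mulf_eq0 !invr_eq0 !mulf_eq0 (gt_eqF nn) (gt_eqF l_gt0) pnatr_eq0 /=.
by rewrite !orbF lorentzC => /eqP.
Qed.

(** The Laplacian of [ln (r - 1)], for [r] the square of [y] with first
    derivatives [p, q] and second derivatives [a, b]. *)
Lemma ln_laplacian_lt0 y a b (r := lorentz y y) : 1 < r ->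
  lorentz y (a + b) = 0 ->
  (lorentz a y + lorentz p p + (lorentz p p + lorentz y a)) / (r - 1)
    - (lorentz p y + lorentz y p) ^+ 2 / (r - 1) ^+ 2 +
  ((lorentz b y + lorentz q q + (lorentz q q + lorentz y b)) / (r - 1)
    - (lorentz q y + lorentz y q) ^+ 2 / (r - 1) ^+ 2) < 0.
Proof.
move=> r1; rewrite lorentzC lorentzDl => /eqP; rewrite addr_eq0 => /eqP L0.
have tan := lorentz_tangential y; rewrite -/r in tan.
have rp : 0 < r - 1 by rewrite subr_gt0.
have r0 : r - 1 != 0 by rewrite gt_eqF.
rewrite ![lorentz y _]lorentzC L0 pp qq in tan *.
rewrite (_ : _ + _ = 4 * (l * (r - 1) - (lorentz p y ^+ 2
   + lorentz q y ^+ 2)) / (r - 1) ^+ 2); last by field.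
rewrite pmulr_llt0 ?invr_gt0 ?exprn_gt0// pmulr_rlt0// subr_lt0.
by apply: lt_le_trans tan; rewrite ltr_pM2l// gtrBl.
Qed.

End ConformalFrame.
End LorentzAlgebra.

Section Patch.
Variable R : realType.
Implicit Types (Y F G : R * R -> 'rV[R]_3) (u v : R * R).

Lemma is_derive_lorentz F G u v : derivable F u v -> derivable G u v ->
  is_derive u v (fun w => lorentz (F w) (G w))
    (lorentz ('D_v F u) (G u) + lorentz (F u) ('D_v G u)).
Proof.
move=> dF dG; have F' i := is_derive_coord 0 i dF.
have G' i := is_derive_coord 0 i dG.
rewrite /lorentz /x1 /x2 /x3; apply: is_derive_eq.
by rewrite /GRing.scale /=; ring.
Qed.

Lemma near_eq_pd (V : normedModType R) (X Y : R * R -> V) u :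
  (\forall w \near u, X w = Y w) ->
  (\forall w \near u, pd1 X w = pd1 Y w /\ pd2 X w = pd2 Y w).
Proof.
move=> /near_join XY; near=> w.
by split; apply: near_eq_derive; near: w.
Unshelve. all: by end_near. Qed.

Lemma near_eq_spacelike_at X Y u : (\forall w \near u, X w = Y w) ->
  spacelike_at X u -> spacelike_at Y u.
Proof.
move=> /near_eq_pd /nbhs_singleton[E1 E2] sX a b ab.
by rewrite -E1 -E2; exact: sX.
Qed.

Lemma near_eq_mean_curvature X Y u : (\forall w \near u, X w = Y w) ->
  mean_curvature X u = mean_curvature Y u.
Proof.
move=> /near_eq_pd H; have [E1 E2] := nbhs_singleton H.
have H1 : \forall w \near u, pd1 X w = pd1 Y w by apply: filterS H => w [].
have H2 : \forall w \near u, pd2 X w = pd2 Y w by apply: filterS H => w [].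
have [E11 E21] := nbhs_singleton (near_eq_pd H1).
have [_ E22] := nbhs_singleton (near_eq_pd H2).
have EM Z : mean_curvature Z u = curvature_of (pd1 Z u) (pd2 Z u)
    (pd1 (pd1 Z) u) (pd2 (pd1 Z) u) (pd2 (pd2 Z) u) by [].
have M_eq (p p' q q' a a' b b' c c' : 'rV[R]_3) : p = p' -> q = q' -> a = a' ->
    b = b' -> c = c' -> curvature_of p q a b c = curvature_of p' q' a' b' c'.
  by move=> -> -> -> -> ->.
rewrite (EM X) (EM Y).
exact: (M_eq _ _ _ _ _ _ _ _ _ _ E1 E2 E11 E21 E22).
Qed.

Lemma has_second_ln_lorentz Y u v (p := 'D_v Y) : {for u, continuous Y} ->
  (\forall w \near u, derivable Y w v) -> derivable p u v ->
  1 < lorentz (Y u) (Y u) ->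
  has_second (fun w => ln (lorentz (Y w) (Y w) - 1)) u v
    ((lorentz ('D_v p u) (Y u) + lorentz (p u) (p u)
       + (lorentz (p u) (p u) + lorentz (Y u) ('D_v p u)))
       / (lorentz (Y u) (Y u) - 1)
     - (lorentz (p u) (Y u) + lorentz (Y u) (p u)) ^+ 2
       / (lorentz (Y u) (Y u) - 1) ^+ 2).
Proof.
move=> cY dY dp Y1; have dYu : derivable Y u v by exact: nbhs_singleton dY.
have cr : {for u, continuous (fun w => lorentz (Y w) (Y w))}.
  have c i : {for u, continuous (fun w => Y w 0 i)}.
    exact: (continuous_comp cY (@coord_continuous _ _ _ _ _ _)).
  by rewrite /lorentz; apply: cvgB; [apply: cvgD|]; apply: cvgM; exact: c.
pose d w := lorentz (p w) (Y w) + lorentz (Y w) (p w).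
apply: (@has_second_ln _ _ d) => //.
  by near=> w; apply: is_derive_lorentz; near: w.
by apply: is_deriveD; exact: is_derive_lorentz.
Unshelve. all: by end_near. Qed.

Section Conformal.
Variables (A : set (R * R)) (Y : R * R -> 'rV[R]_3) (u : R * R).
Hypotheses (oA : open A) (Au : A u) (YC2 : Ck 2 A Y).
Hypothesis Yconf : forall w, A w -> conformal_at Y w.

Let nearA : \forall w \near u, A w.
Proof. exact: open_nbhs_nbhs. Qed.

Let dY w : A w -> derivable Y w (1, 0) /\ derivable Y w (0, 1).
Proof. by case: YC2 => _ [+ _ _]; apply. Qed.

Let dY1 w : A w -> derivable (pd1 Y) w (1, 0) /\ derivable (pd1 Y) w (0, 1).
Proof. by case: YC2 => _ [_ [_ [+ _ _]] _]; apply. Qed.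

Let dY2 w : A w -> derivable (pd2 Y) w (1, 0) /\ derivable (pd2 Y) w (0, 1).
Proof. by case: YC2 => _ [_ _ [_ [+ _ _]]]; apply. Qed.

Lemma mixed_partials : pd1 (pd2 Y) u = pd2 (pd1 Y) u.
Proof.
have c12 : {for u, continuous (pd2 (pd1 Y))}.
  by case: YC2 => _ [_ [_ [_ _ [+ _]]] _]; apply.
have c21 : {for u, continuous (pd1 (pd2 Y))}.
  by case: YC2 => _ [_ _ [_ [_ [+ _] _]]]; apply.
apply/rowP => i; apply/esym.
apply: (@schwarz _ _ (fun w => Y w 0 i) (fun w => pd1 Y w 0 i)
  (fun w => pd2 Y w 0 i) (fun w => pd2 (pd1 Y) w 0 i)
  (fun w => pd1 (pd2 Y) w 0 i) u (1, 0) (0, 1)).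
- by near=> w; apply: is_derive_coord; apply: (dY _).1; near: w.
- by near=> w; apply: is_derive_coord; apply: (dY _).2; near: w.
- by near=> w; apply: is_derive_coord; apply: (dY1 _).2; near: w.
- by near=> w; apply: is_derive_coord; apply: (dY2 _).1; near: w.
- exact: (continuous_comp c12 (@coord_continuous _ _ _ _ _ _)).
- exact: (continuous_comp c21 (@coord_continuous _ _ _ _ _ _)).
Unshelve. all: by end_near. Qed.

(** The Laplacian of a conformal map is normal to its image. *)
Lemma conformal_laplacian_normal :
  lorentz (pd1 (pd1 Y) u + pd2 (pd2 Y) u) (pd1 Y u) = 0 /\
  lorentz (pd1 (pd1 Y) u + pd2 (pd2 Y) u) (pd2 Y u) = 0.
Proof.
have EG v : 'D_v (ffE Y) u = 'D_v (ffG Y) u.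
  by apply: near_eq_derive; near=> w; apply: (Yconf _).1; near: w.
have F0 v : 'D_v (ffF Y) u = 0.
  rewrite (@near_eq_derive _ _ _ _ (cst 0)) ?derive_cst//.
  by near=> w; apply: (Yconf _).2; near: w.
have [d11 d12] := dY1 Au; have [d21 d22] := dY2 Au.
have D F G v : derivable F u v -> derivable G u v ->
    'D_v (fun w => lorentz (F w) (G w)) u =
    lorentz ('D_v F u) (G u) + lorentz ('D_v G u) (F u).
  move=> dF dG; rewrite [X in _ + X]lorentzC.
  exact: (@derive_val _ _ _ _ _ _ _ (is_derive_lorentz dF dG)).
set p := pd1 Y u; set q := pd2 Y u.
set a := pd1 (pd1 Y) u; set b := pd2 (pd2 Y) u; set m := pd2 (pd1 Y) u.
have mE : 'D_(1, 0) (pd2 Y) u = m by exact: mixed_partials.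
have E1 : lorentz a p + lorentz a p = lorentz m q + lorentz m q.
  rewrite -mE; exact: (etrans (esym (D _ _ _ d11 d11)) (etrans (EG _) (D _ _ _ d21 d21))).
have E2 : lorentz m p + lorentz m p = lorentz b q + lorentz b q.
  exact: (etrans (esym (D _ _ _ d12 d12)) (etrans (EG _) (D _ _ _ d22 d22))).
have F1 : lorentz a q + lorentz m p = 0.
  rewrite -mE; exact: (etrans (esym (D _ _ _ d11 d21)) (F0 _)).
have F2 : lorentz m q + lorentz b p = 0.
  exact: (etrans (esym (D _ _ _ d12 d22)) (F0 _)).
clear mE; clearbody a b m p q; by split; rewrite lorentzDl; lra.
Unshelve. all: by end_near. Qed.

Hypotheses (Ysp : spacelike_at Y u) (Yh : mean_curvature Y u = 0).

Lemma ffE_gt0 : 0 < ffE Y u.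
Proof.
have := @Ysp 1 0; rewrite scale1r scale0r addr0; apply.
by rewrite xpair_eqE oner_eq0.
Qed.

Lemma conformal_frame :
  [/\ lorentz (pd1 Y u) (pd1 Y u) = ffE Y u,
      lorentz (pd2 Y u) (pd2 Y u) = ffE Y u &
      lorentz (pd1 Y u) (pd2 Y u) = 0].
Proof. by have [EG F] := Yconf Au; split; [exact: erefl|exact: esym EG|exact: F]. Qed.

(** The coordinates of a conformal maximal immersion are harmonic. *)
Lemma maximal_laplacian (v : 'rV[R]_3) :
  lorentz v (pd1 (pd1 Y) u + pd2 (pd2 Y) u) = 0.
Proof.
have [pp qq pq] := conformal_frame.
have [L1 L2] := conformal_laplacian_normal.
have Ln := curvature_of_eq0 pp qq pq ffE_gt0 Yh.
exact: (@lorentz_orthogonal _ _ _ _ pp qq pq ffE_gt0 v _ L1 L2 Ln).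
Qed.

(** The logarithm of the Lorentzian square is strictly superharmonic on a
    conformal maximal immersion. *)
Lemma ln_lorentz_superharmonic : 1 < lorentz (Y u) (Y u) ->
  exists2 l, l < 0 & has_laplacian (fun w => ln (lorentz (Y w) (Y w) - 1)) u l.
Proof.
move=> Y1; have [pp qq pq] := conformal_frame.
have cY : {for u, continuous Y} by case: YC2 => cY _; exact: cY.
have dn1 : \forall w \near u, derivable Y w (1, 0).
  by near=> w; apply: (dY _).1; near: w.
have dn2 : \forall w \near u, derivable Y w (0, 1).
  by near=> w; apply: (dY _).2; near: w.
have s1 := has_second_ln_lorentz cY dn1 (dY1 Au).1 Y1.
have s2 := has_second_ln_lorentz cY dn2 (dY2 Au).2 Y1.
eexists; last by do 2 eexists; split; [exact: s1|exact: s2|reflexivity].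
exact: (ln_laplacian_lt0 pp qq pq ffE_gt0 Y1 (maximal_laplacian (Y u))).
Unshelve. all: by end_near. Qed.

End Conformal.
End Patch.

(** * The strong maximum principle in the plane *)

Section StrongMaximum.
Variable R : realType.
Implicit Types (u v w a q z : R * R).

(** The closed square with centre [a] and half-side [r]. *)
Definition square a (r : R) : set (R * R) :=
  [set w | `|w.1 - a.1| <= r /\ `|w.2 - a.2| <= r].

Lemma compact_square a r : compact (square a r).
Proof.
rewrite (_ : square a r = `[a.1 - r, a.1 + r] `*` `[a.2 - r, a.2 + r]).
  by apply: compact_setX; exact: segment_compact.
by apply/seteqP; split => w; rewrite /square /= !in_itv /= !ler_distl.
Qed.

(** A continuous function that stays below [m] on a compact set stays away from
    [m]. *)
Lemma compact_gap (g : R * R -> R) (E : set (R * R)) (m : R) :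
  compact E -> {within E, continuous g} -> (forall w, E w -> g w < m) ->
  exists2 eta, 0 < eta & forall w, E w -> g w <= m - eta.
Proof.
move=> cE cg gm; have [->|/set0P E0] := eqVneq E set0; first by exists 1.
have [c /set_mem Ec cmax] := compact_EVT_max E0 cE cg.
exists (m - g c) => [|w Ew]; first by rewrite subr_gt0 gm.
by rewrite opprB addrC subrK cmax// inE.
Qed.

Lemma compact_superlevel (T : topologicalType) (g : T -> R) (K : set T) (m : R) :
  compact K -> {within K, continuous g} -> compact (K `&` [set w | m <= g w]).
Proof.
move=> cK cg.
have /closed_subspaceP[V cV VE] :=
  (continuous_closedP (g : subspace K -> R)).1 cg _ (@closed_ge R m).
by rewrite setIC -VE setIC; exact: compact_closedI.
Qed.

Section Barrier.
Variables (a z : R * R).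
Let d2 := z.1 ^+ 2 + z.2 ^+ 2.
Let s w := (w.1 - a.1) * z.1 + (w.2 - a.2) * z.2.
Let t w := (w.1 - a.1) * z.2 - (w.2 - a.2) * z.1.

(** A strictly subharmonic function vanishing at [a] and, close to [a] but not at
    [a], nonnegative only inside the disc centred at [a + z] whose boundary
    contains [a].  Up to a factor, [s] and [t] are the coordinates along [z] and
    orthogonally to [z]; since [4 > 3], the Laplacian is positive. *)
Definition barrier w := d2 * s w + 4 * s w ^+ 2 - 3 * t w ^+ 2.

Lemma barrier_center : barrier a = 0.
Proof. by rewrite /barrier /s /t !subrr; ring. Qed.

Lemma continuous_fst_snd_sub (b : R * R) :
  continuous (fun w : R * R => w.1 - b.1) /\
  continuous (fun w : R * R => w.2 - b.2).
Proof.
by split=> w; apply: cvgB; [exact: cvg_fst|exact: cvg_cst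
                           |exact: cvg_snd|exact: cvg_cst].
Qed.

Lemma continuous_barrier : continuous barrier.
Proof.
have [c1 c2] := continuous_fst_snd_sub a.
have cs w : {for w, continuous s}.
  by apply: cvgD; (apply: cvgM; last exact: cvg_cst); [exact: c1|exact: c2].
have ct w : {for w, continuous t}.
  by apply: cvgB; (apply: cvgM; last exact: cvg_cst); [exact: c1|exact: c2].
move=> w; apply: cvgB; [apply: cvgD|].
- by apply: cvgM; [exact: cvg_cst|exact: cs].
- by apply: cvgM; [exact: cvg_cst|exact: (cvgM (cs w) (cs w))].
- by apply: cvgM; [exact: cvg_cst|exact: (cvgM (ct w) (ct w))].
Qed.

Lemma has_second_barrier u v : has_second barrier u v
  (8 * (v.1 * z.1 + v.2 * z.2) ^+ 2 - 6 * (v.1 * z.2 - v.2 * z.1) ^+ 2).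
Proof.
pose sv := v.1 * z.1 + v.2 * z.2; pose tv := v.1 * z.2 - v.2 * z.1.
have sE w h : s (h *: v + w) = h * sv + s w.
  by rewrite /s /sv /= /GRing.scale /=; ring.
have tE w h : t (h *: v + w) = h * tv + t w.
  by rewrite /t /tv /= /GRing.scale /=; ring.
have ds w : is_derive w v s sv.
  rewrite -[w in is_derive w](add0r w) -(scale0r v).
  apply: (is_derive_line _ _ _ _ _).2.
  rewrite (_ : (fun h => s (h *: v + w)) = (fun h => h * sv + s w)).
    by apply: is_derive_eq; rewrite /GRing.scale /=; ring.
  by apply/funext => h; exact: sE.
have dt w : is_derive w v t tv.
  rewrite -[w in is_derive w](add0r w) -(scale0r v).
  apply: (is_derive_line _ _ _ _ _).2.
  rewrite (_ : (fun h => t (h *: v + w)) = (fun h => h * tv + t w)).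
    by apply: is_derive_eq; rewrite /GRing.scale /=; ring.
  by apply/funext => h; exact: tE.
exists (fun w => d2 * sv + 8 * sv * s w - 6 * tv * t w).
  near=> w; rewrite /barrier; apply: is_derive_eq.
  by rewrite /GRing.scale /=; ring.
by apply: is_derive_eq; rewrite /GRing.scale /= -/sv -/tv; ring.
Unshelve. all: by end_near. Qed.

Lemma has_laplacian_barrier u : has_laplacian barrier u (2 * d2).
Proof.
exists (8 * z.1 ^+ 2 - 6 * z.2 ^+ 2), (8 * z.2 ^+ 2 - 6 * z.1 ^+ 2).
split; last by rewrite /d2; ring.
  have := has_second_barrier u (1, 0).
  by rewrite /= !mul1r !mul0r addr0 subr0.
have := has_second_barrier u (0, 1).
by rewrite /= !mul1r !mul0r add0r sub0r sqrrN.
Qed.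

Lemma barrier_ge0 w : `|s w| <= d2 / 8 -> 0 <= barrier w -> w <> a -> 0 < d2 ->
  (w.1 - (a + z).1) ^+ 2 + (w.2 - (a + z).2) ^+ 2 < d2.
Proof.
move=> sw bw wa d0; rewrite /barrier in bw.
pose n := (w.1 - a.1) ^+ 2 + (w.2 - a.2) ^+ 2.
have nE : n * d2 = s w ^+ 2 + t w ^+ 2 by rewrite /n /d2 /s /t; ring.
have n0 : 0 < n.
  rewrite lt0r addr_ge0 ?sqr_ge0// andbT paddr_eq0 ?sqr_ge0// !sqrf_eq0 !subr_eq0.
  apply/negP => /andP[/eqP e1 /eqP e2]; apply: wa.
  by rewrite [w]surjective_pairing e1 e2 -surjective_pairing.
have -> : (w.1 - (a + z).1) ^+ 2 + (w.2 - (a + z).2) ^+ 2 = n - 2 * s w + d2.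
  by rewrite /n /s /d2 /=; ring.
rewrite gtrDr -(pmulr_llt0 _ d0) mulrBl nE.
have nd : 0 < s w ^+ 2 + t w ^+ 2 by rewrite -nE mulr_gt0.
move: sw bw nd; rewrite ler_norml => /andP[]; clear -d0.
move: (s w) (t w) d2 d0 => x y d d0 xl xr b n0.
have y2 : 0 <= y ^+ 2 by exact: sqr_ge0.
have x0 : 0 < x.
  rewrite ltNge; apply/negP => x0.
  have : 0 <= x * (d + 4 * x) by nra.
  have dx : 0 < d + 4 * x by lra.
  rewrite pmulr_lge0// => x0'; have xE : x = 0 by lra.
  by rewrite xE in b n0; nra.
by nra.
Qed.

End Barrier.

(** Hopf's argument: if [g] were smaller than [m] at some point [q], then the
    largest disc around [q] free from maxima would have a maximum [a] on its
    boundary, and adding a small multiple of the barrier at [a] would create an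
    interior maximum of a strictly subharmonic function. *)
Lemma strong_maximum_plane (g : R * R -> R) u (r m : R) : 0 < r ->
  (forall w, square u r w -> {for w, continuous g}) ->
  (forall w, square u r w -> has_laplacian g w 0) ->
  (forall w, square u r w -> g w <= m) -> g u = m ->
  forall q, square u (r / 8) q -> g q = m.
Proof.
move=> r0 cg lg gm gu q [q1 q2].
have cgw E : E `<=` square u r -> {within E, continuous g}.
  move=> Er; apply: continuous_in_subspaceT => w /set_mem /Er; exact: cg.
have qr : square u r q by split; [move: q1|move: q2]; move=> /le_trans; apply; lra.
apply/eqP; apply: contraT => gq; have {}gq : g q < m by rewrite lt_neqAle gq gm.
pose n w := (w.1 - q.1) ^+ 2 + (w.2 - q.2) ^+ 2.
have cn : continuous n.
  have [c1 c2] := continuous_fst_snd_sub q.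
  by move=> w; apply: cvgD; [exact: (cvgM (c1 w) (c1 w))|exact: (cvgM (c2 w) (c2 w))].
pose K := square u r `&` [set w | m <= g w].
have cK : compact K by apply: compact_superlevel; [exact: compact_square|exact: cgw].
have Ku : K u by split; [rewrite /square /= !subrr !normr0 ltW|rewrite /= gu].
(* A point of the level set nearest to [q] for the Euclidean distance. *)
have [a /set_mem[ar ga] amin] : exists2 a, a \in K & forall w, w \in K -> n a <= n w.
  apply: compact_EVT_min; [by exists u|by []|].
  exact: continuous_subspaceT.
have {}ga : g a = m by apply/eqP; rewrite eq_le ga gm.
have inside w : square u r w -> n w < n a -> g w < m.
  move=> wr wa; rewrite ltNge; apply/negP => mw.
  by have := amin w; rewrite inE leNgt wa => /(_ (conj wr mw)).
have nau : n a <= n u by apply: amin; rewrite inE.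
have nu : n u <= 2 * (r / 8) ^+ 2.
  have sq x : `|x| <= r / 8 -> x ^+ 2 <= (r / 8) ^+ 2.
    by move=> xr; rewrite -real_normK ?num_real// lerXn2r// nnegrE; lra.
  have := sq _ q1; have := sq _ q2; rewrite /n.
  by rewrite -(sqrrN (u.1 - _)) -(sqrrN (u.2 - _)) !opprB; lra.
pose z := q - a; pose d2 := z.1 ^+ 2 + z.2 ^+ 2.
have nE : n a = d2 by rewrite /n /d2 /z /=; ring.
have d0 : 0 < d2.
  rewrite lt0r addr_ge0 ?sqr_ge0// andbT paddr_eq0 ?sqr_ge0// !sqrf_eq0 !subr_eq0.
  apply/negP => /andP[/eqP e1 /eqP e2]; move: gq.
  by rewrite [q]surjective_pairing e1 e2 -surjective_pairing ga ltxx.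
have az : a + z = q by rewrite /z addrC subrK.
have [a1 a2] : `|a.1 - u.1| <= r / 2 /\ `|a.2 - u.2| <= r / 2.
  have near x : x ^+ 2 <= 2 * (r / 8) ^+ 2 -> `|x| <= r / 4.
    move=> xr; rewrite -(@ler_pXn2r _ 2) ?nnegrE ?real_normK ?num_real//; nra.
  have p1 : `|a.1 - q.1| <= r / 4.
    by apply: near; apply: le_trans nu; apply: le_trans nau; rewrite lerDl sqr_ge0.
  have p2 : `|a.2 - q.2| <= r / 4.
    by apply: near; apply: le_trans nu; apply: le_trans nau; rewrite lerDr sqr_ge0.
  split.
    by move: p1 q1; rewrite !ler_norml => /andP[? ?] /andP[? ?]; apply/andP; split; lra.
  by move: p2 q2; rewrite !ler_norml => /andP[? ?] /andP[? ?]; apply/andP; split; lra.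
(* Half-side [e] of a square around [a] on which [barrier_ge0] applies. *)
pose l := `|z.1| + `|z.2| + 1; have l0 : 0 < l by rewrite ltr_wpDl.
pose e := Num.min (r / 2) (d2 / 8 / l).
have e0 : 0 < e by rewrite lt_min !divr_gt0.
have er : e <= r / 2 by rewrite ge_min lexx.
have el : e * (`|z.1| + `|z.2|) <= d2 / 8.
  have : e * l <= d2 / 8 by rewrite -ler_pdivlMr// ge_min lexx orbT.
  by apply: le_trans; rewrite ler_pM2l// lerDl.
have sqsub w : square a e w -> square u r w.
  move=> [w1 w2]; split.
    by move: a1 w1; rewrite !ler_norml => /andP[? ?] /andP[? ?]; apply/andP; split; lra.
  by move: a2 w2; rewrite !ler_norml => /andP[? ?] /andP[? ?]; apply/andP; split; lra.
have ssmall w : square a e w ->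
    `|(w.1 - a.1) * z.1 + (w.2 - a.2) * z.2| <= d2 / 8.
  move=> [w1 w2]; apply: le_trans el; rewrite [leRHS]mulrDr.
  by rewrite (le_trans (ler_normD _ _))// !normrM lerD// ler_wpM2r.
pose b := barrier a z.
have bup w : square a e w -> b w <= d2 ^+ 2 / 2.
  move=> /ssmall; rewrite /b /barrier -/d2.
  move: (_ + _ * z.2) (_ - _ * z.1) => x y; rewrite ler_norml => /andP[? ?].
  by have := sqr_ge0 y; nra.
(* Outside the open square; [g < m] on the part of the border where [b >= 0]. *)
pose bd := [set w : R * R | e <= `|w.1 - a.1|] `|` [set w | e <= `|w.2 - a.2|].
pose E := (square a e `&` [set w | 0 <= b w]) `&` bd.
have cE : compact E.
  apply: compact_closedI.
    apply: compact_superlevel; first exact: compact_square.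
    by apply: continuous_subspaceT; exact: continuous_barrier.
  have [c1 c2] := continuous_fst_snd_sub a.
  have cn1 : continuous (fun w : R * R => `|w.1 - a.1|).
    by move=> w; apply: cvg_norm; exact: c1.
  have cn2 : continuous (fun w : R * R => `|w.2 - a.2|).
    by move=> w; apply: cvg_norm; exact: c2.
  apply: closedU.
    exact: ((continuous_closedP _).1 cn1 _ (@closed_ge R e)).
  exact: ((continuous_closedP _).1 cn2 _ (@closed_ge R e)).
have [eta eta0 gE] : exists2 eta, 0 < eta & forall w, E w -> g w <= m - eta.
  apply: compact_gap => //; first by apply: cgw => w [[/sqsub]].
  move=> w [[wa bw] wbd]; apply: inside; first exact: sqsub.
  rewrite nE /n -az; apply: (barrier_ge0 _ bw) => //; first exact: ssmall.
  by move=> wE; move: wbd; rewrite wE /bd /= !subrr normr0 leNgt e0 => -[].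
(* As [b <= d2 ^+ 2 / 2] on the square, this multiple of [b] stays below [eta]. *)
pose k w := g w + (eta / d2 ^+ 2) * b w.
have k0 : 0 < eta / d2 ^+ 2 by rewrite divr_gt0// exprn_gt0.
have [c /set_mem ca cmax] :
    exists2 c, c \in square a e & forall w, w \in square a e -> k w <= k c.
  apply: compact_EVT_max; last 1 first.
  - apply: continuous_in_subspaceT => w /set_mem /sqsub wr.
    apply: cvgD; first exact: cg.
    by apply: cvgM; [exact: cvg_cst|exact: continuous_barrier].
  - by exists a; rewrite /square /= !subrr !normr0 ltW.
  - exact: compact_square.
have km : m <= k c.
  have := cmax a; rewrite inE /k /b barrier_center mulr0 addr0 ga; apply.
  by rewrite /square /= !subrr !normr0 ltW.
have cin : ~ bd c.
  move=> cbd; move: km; apply/negP; rewrite -ltNge /k.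
  have [bc|bc] := leP 0 (b c).
    have gc : g c <= m - eta by apply: gE.
    have : eta / d2 ^+ 2 * b c <= eta / 2.
      apply: (le_trans (ler_wpM2l (ltW k0) (bup _ ca))).
      by rewrite mulrA divfK// gt_eqF// exprn_gt0.
    by lra.
  have gc : g c <= m by apply: gm; exact: sqsub.
  have : eta / d2 ^+ 2 * b c < 0 by rewrite pmulr_rlt0.
  by lra.
have kloc : \forall w \near c, k w <= k c.
  have c1 : `|c.1 - a.1| < e by rewrite ltNge; apply/negP => ?; apply: cin; left.
  have c2 : `|c.2 - a.2| < e by rewrite ltNge; apply/negP => ?; apply: cin; right.
  have [e1 e1p] : exists2 e1, 0 < e1 & e1 <= e - `|c.1 - a.1| /\ e1 <= e - `|c.2 - a.2|.
    exists (Num.min (e - `|c.1 - a.1|) (e - `|c.2 - a.2|)).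
      by rewrite lt_min !subr_gt0 c1.
    by rewrite !ge_min !lexx orbT.
  move=> [m1 m2]; apply/nbhs_ballP; exists e1 => //= w [w1 w2].
  apply: cmax; rewrite inE; split.
    move: w1; rewrite /ball /= distrC => w1.
    rewrite -(subrKA c.1) (le_trans (ler_normD _ _))//; lra.
  move: w2; rewrite /ball /= distrC => w2.
  rewrite -(subrKA c.2) (le_trans (ler_normD _ _))//; lra.
have lk : has_laplacian k c (0 + (eta / d2 ^+ 2) * (2 * d2)).
  apply: has_laplacianD; first by apply: lg; exact: sqsub.
  by apply: has_laplacianZ; exact: has_laplacian_barrier.
have := has_laplacian_le0 lk kloc; rewrite add0r leNgt => /negP; case.
by rewrite mulr_gt0// mulr_gt0.
Qed.

End StrongMaximum.

(** * Charts *)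

Section PlaneCoordinates.
Variable R : realType.

(** Inverse of the identification [cplx] of [R * R] with the complex plane. *)
Definition uncplx (z : Cplane R) : R * R := (complex.Re z, complex.Im z).

Lemma cplxK : cancel (@cplx R) uncplx.
Proof. by case. Qed.

Lemma uncplxK : cancel uncplx (@cplx R).
Proof. by case. Qed.

Lemma continuous_cplx : continuous (@cplx R).
Proof.
move=> u; apply/cvgrPdist_lt => /= e e0.
have eE : e = (complex.Re e)%:C%C.
  by case: e e0 => a b; rewrite ltcE /= => /andP[/eqP -> _].
have {}e0 : 0 < complex.Re e / 2.
  by move: e0; rewrite {1}eE (ltcR 0) => ?; rewrite divr_gt0.
apply: filterS (nbhsx_ballx u _ e0) => w [w1 w2].
rewrite eE normc_def ltcR /=.
rewrite /ball /= in w1 w2; move: w1 w2.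
set x := u.1 - w.1; set y := u.2 - w.2 => xe ye.
apply: (@le_lt_trans _ _ (`|x| + `|y|)); last by rewrite (splitr (complex.Re e)) ltrD.
rewrite -(@ler_pXn2r _ 2) ?nnegrE ?sqrtr_ge0 ?addr_ge0//.
rewrite sqr_sqrtr ?addr_ge0 ?sqr_ge0// -[leLHS]/(x ^+ 2 + y ^+ 2).
move: xe ye; clearbody x y => _ _; rewrite sqrrD !real_normK ?num_real//.
by rewrite addrAC lerDl mulrn_wge0// mulr_ge0.
Qed.

Lemma continuous_uncplx : continuous uncplx.
Proof.
move=> z; apply: (@cvgrPdist_lt _ _ _ (nbhs z) (nbhs_filter z) _ _).2.
move=> /= e e0.
have e0C : 0 < e%:C%C :> Cplane R by rewrite (ltcR 0).
have nRe (x : R[i]) : `|complex.Re x|%:C%C <= `|x| by exact: normc_ge_Re.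
have nIm (x : R[i]) : `|complex.Im x|%:C%C <= `|x|.
  by rewrite normc_def lecR -sqrtr_sqr ler_wsqrtr// lerDr sqr_ge0.
have nb : \forall w \near z, `|z - w| < e%:C%C.
  exact: ((@cvgrPdist_lt _ _ _ (nbhs z) (nbhs_filter z) id z).1 (@cvg_id _ _) _ e0C).
near=> w; have zw : `|z - w| < e%:C%C by near: w.
have r1 := le_lt_trans (nRe _) zw; have r2 := le_lt_trans (nIm _) zw.
rewrite !ltcR in r1 r2.
have ReB (x y : R[i]) : complex.Re (x - y) = complex.Re x - complex.Re y.
  by case: x; case: y.
have ImB (x y : R[i]) : complex.Im (x - y) = complex.Im x - complex.Im y.
  by case: x; case: y.
by rewrite prod_normE /= gt_max -ReB -ImB r1.
Unshelve. all: by end_near. Qed.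

Lemma has_laplacian_Ck2 (A : set (R * R)) (g : R * R -> R) u :
  open A -> A u -> Ck 2 A g ->
  has_laplacian g u (pd1 (pd1 g) u + pd2 (pd2 g) u).
Proof.
move=> oA Au [_ [dg [_ [dg1 _ _]] [_ [dg2 _ _]]]].
have nA : \forall w \near u, A w by exact: open_nbhs_nbhs.
exists (pd1 (pd1 g) u), (pd2 (pd2 g) u); split; last exact: erefl.
- exists (pd1 g); last exact: derivableP (dg1 u Au).1.
  by near=> w; apply: derivableP; apply: (dg _ _).1; near: w.
- exists (pd2 g); last exact: derivableP (dg2 u Au).2.
  by near=> w; apply: derivableP; apply: (dg _ _).2; near: w.
Unshelve. all: by end_near. Qed.

End PlaneCoordinates.

Section Charts.
Variables (R : realType) (T : topologicalType) (S : riemann_surface R T).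
Implicit Types (c : chart R T) (A O : set T) (p : T).

(** Neighbourhoods of a point of a chart domain are those of its coordinates. *)
Lemma near_chart c p (P : set T) : dom c p ->
  (\forall w \near uncplx (c p), P (param c (cplx w))) <->
  (\forall q \near p, P q).
Proof.
move=> cp; split=> H.
- have cc : {for p, continuous (Defs.coord c)}.
    have := @Defs.coord_continuous _ _ c;
    rewrite continuous_open_subspace; last exact: dom_open.
    by apply; rewrite inE.
  have H1 : \forall q \near p, P (param c (cplx (uncplx (c q)))).
    exact: (continuous_comp cc (@continuous_uncplx R _)) H.
  have H2 : \forall q \near p, dom c q.
    by apply: open_nbhs_nbhs; split=> //; exact: dom_open.
  near=> q; have dq : dom c q by near: q.
  have : P (param c (cplx (uncplx (c q)))) by near: q.
  by rewrite uncplxK coordK.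
- have pc : {for cplx (uncplx (c p)), continuous (param c)}.
    have := @param_continuous _ _ c.
    rewrite continuous_open_subspace; last exact: img_open.
    by apply; rewrite inE uncplxK; exists p.
  have pcp : param c (cplx (uncplx (c p))) = p by rewrite uncplxK coordK.
  rewrite -pcp in H.
  exact: (continuous_comp (@continuous_cplx R _) pc) H.
Unshelve. all: by end_near. Qed.

Lemma local_uncplx c p (V : Type) (f : T -> V) : dom c p ->
  local c f (uncplx (c p)) = f p.
Proof. by move=> cp; rewrite /local uncplxK coordK. Qed.

Lemma local_set_uncplx c A p : dom c p -> A p -> local_set c A (uncplx (c p)).
Proof. by move=> cp Ap; exists p; rewrite ?uncplxK. Qed.

Lemma local_setE c A u : local_set c A u ->
  exists2 p, dom c p /\ A p & u = uncplx (c p).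
Proof. by move=> [p Ap cp]; exists p; rewrite // cp cplxK. Qed.

Lemma open_local_set c A : open A -> open (local_set c A).
Proof.
move=> oA; rewrite openE => u /local_setE[p [cp Ap] ->].
have oc := @img_open _ _ c.
have nA : \forall w \near uncplx (c p), A (param c (cplx w)).
  by apply/near_chart => //; exact: open_nbhs_nbhs.
have nc : \forall w \near uncplx (c p), (c @` dom c) (cplx w).
  have := @continuous_cplx R (uncplx (c p)); apply; rewrite uncplxK.
  by apply: open_nbhs_nbhs; split=> //; exists p.
apply: filterS2 nA nc => w Aw [q cq qw]; exists q => //.
by split=> //; move: Aw; rewrite -qw coordK.
Qed.

Lemma smooth_continuous (V : normedModType R) (Y : T -> V) :
  smooth_on S setT Y -> continuous Y.
Proof.
move=> sY p; have [c Sc cp] := atlas_cover S p.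
have [cY _] := sY c Sc 0%N.
move=> W; rewrite -(local_uncplx Y cp) => /(cY _ (local_set_uncplx cp I)) H.
by apply/(near_chart _ cp).
Qed.

Lemma local_max_chart c p (f : T -> R) : dom c p ->
  (\forall q \near p, f q <= f p) ->
  \forall w \near uncplx (c p), local c f w <= local c f (uncplx (c p)).
Proof.
by move=> cp fmax; rewrite (local_uncplx f cp); apply/(near_chart [set q | f q <= f p]).
Qed.

(** The level set of the maximum of a harmonic function is open. *)
Lemma strong_maximum O (f : T -> R) (m : R) : open O ->
  (forall c, atlas S c -> forall u, local_set c O u ->
     {for u, continuous (local c f)} /\ has_laplacian (local c f) u 0) ->
  (forall p, O p -> f p <= m) ->
  forall p, O p -> f p = m -> \forall q \near p, f q = m.
Proof.
move=> oO fh fm p Op fp; have [c Sc cp] := atlas_cover S p.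
have : nbhs (uncplx (c p)) (local_set c O).
  by apply: open_nbhs_nbhs; split; [exact: open_local_set|exact: local_set_uncplx].
move=> /nbhs_ballP[r /= r0 ball_r].
have sq w : square (uncplx (c p)) (r / 2) w -> local_set c O w.
  move=> [w1 w2]; apply: ball_r; split; rewrite /ball /= distrC.
    by apply: (le_lt_trans w1); rewrite gtr_pMr// invf_lt1// ltr1n.
  by apply: (le_lt_trans w2); rewrite gtr_pMr// invf_lt1// ltr1n.
have r20 : 0 < r / 2 by rewrite divr_gt0.
have H : forall q, square (uncplx (c p)) (r / 2 / 8) q -> local c f q = m.
  apply: (strong_maximum_plane r20).
  - by move=> w /sq /(fh _ Sc)[].
  - by move=> w /sq /(fh _ Sc)[].
  - move=> w /sq /local_setE[q [cq Oq] ->].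
    by rewrite local_uncplx//; exact: fm.
  - by rewrite local_uncplx.
apply/(near_chart [set q | f q = m] cp).
apply/nbhs_ballP; exists (r / 2 / 8); first by rewrite /= !divr_gt0.
move=> w [w1 w2]; apply: H; rewrite /ball /= in w1 w2.
by split; rewrite distrC ltW.
Qed.

End Charts.

(** * Superharmonic functions and relative parabolicity *)

Section Bordered.
Variables (R : realType) (T : topologicalType) (S : riemann_surface R T).
Variables (M B : set T) (MB : bordered S M B).

(** A locally finite union of closed sets is closed. *)
Lemma boundary_closed : closed B.
Proof.
have [F [BE _ Ffin Fcl]] := bordered_curves MB; move=> p clBp.
have [U Up finU] := Ffin p.
pose C := \bigcup_(E in [set E | F E /\ E `&` U !=set0]) E.
have cC : closed C.
  by apply: closed_bigcup => // E [FE _]; exact: (Fcl E FE).1.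
have [Cp|Cp] := pselect (C p).
  by case: Cp => E [FE _] Ep; rewrite BE; exists E.
have nC : nbhs p (~` C) by apply: open_nbhs_nbhs; split=> //; exact: closed_openC.
have [q [Bq [Uq Cq]]] := clBp _ (filterI Up nC).
move: Bq; rewrite BE => -[E FE Eq]; exfalso; apply: Cq.
by exists E => //; split=> //; exists q.
Qed.

Lemma interior_open : open (M `\` B).
Proof.
rewrite openE => p [Mp Bp].
have Mi : nbhs p M.
  apply: contrapT => Mi; apply: Bp; apply: (bordered_frontier MB).
  by split=> //; exact: subset_closure.
have nB : nbhs p (~` B).
  by apply: open_nbhs_nbhs; split=> //; apply: closed_openC; exact: boundary_closed.
exact: filterI Mi nB.
Qed.

Section Exhaustion.
Variables (N u : T -> R) (r : R).
Hypothesis N_cont : {within M, continuous N}.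
Hypothesis N_compact : forall s, compact (M `&` [set p | N p <= s]).
Hypothesis u_cont : {within M `&` [set p | r <= N p], continuous u}.
Hypothesis u_ge0 : forall p, M p -> r <= N p -> 0 <= u p.
Hypothesis u_infty : forall k, exists s, forall p, M p -> s <= N p -> k <= u p.
Hypothesis u_super : forall p, (M `\` B) p -> r < N p ->
  exists c l, [/\ atlas S c, dom c p, l < 0 &
                  has_laplacian (local c u) (uncplx (c p)) l].

Variables (f : T -> R) (k : R).
Hypothesis f_cont : {within M, continuous f}.
Hypothesis f_harm : forall c, atlas S c -> forall w, local_set c (M `\` B) w ->
  {for w, continuous (local c f)} /\ has_laplacian (local c f) w 0.
Hypothesis f_le : forall p, M p -> f p <= k.
Hypothesis f_bdry : forall p, B p -> f p = 0.

(** A bound for [f] on the compact set where [N <= r] extends to [M]. *)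
Lemma maximum_at_infinity m : 0 <= m ->
  (forall p, M p -> N p <= r -> f p <= m) -> forall p, M p -> f p <= m.
Proof.
move=> m0 fm p Mp; have [Np|Np] := leP (N p) r; first exact: fm.
apply/ler_addgt0Pr => e e0.
have up0 : 0 <= u p by apply: u_ge0 => //; exact: ltW.
(* The multiple of [u] to subtract: small enough to cost at most [e] at [p]. *)
pose d := e / (u p + 1).
have d0 : 0 < d by rewrite divr_gt0// ltr_wpDl.
have dup : d * u p <= e.
  by rewrite /d mulrAC ler_pdivrMr ?ltr_wpDl// ler_pM2l// lerDl.
pose v q := f q + - d * u q.
suff vm : v p <= m by move: vm; rewrite /v; lra.
(* Beyond the level [s], the function [v] is nonpositive. *)
have [s us] := u_infty (k / d).
pose s' := Num.max s (N p).
pose C := (M `&` [set q | N q <= s']) `&` [set q | r <= N q].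
have CM : C `<=` M by move=> q [[]].
have Cr : C `<=` M `&` [set q | r <= N q] by move=> q [[]].
have cC : compact C.
  by apply: compact_superlevel => //; apply: continuous_subspaceW N_cont => q [].
have Cp : C p by rewrite /C /s' /= le_max lexx orbT ltW.
have vC : {within C, continuous v}.
  have fC := continuous_subspaceW CM f_cont.
  have uC := continuous_subspaceW Cr u_cont.
  move=> q; apply: cvgD; first exact: fC.
  by apply: cvgM; [exact: cvg_cst|exact: uC].
have [q /set_mem Cq vmax] : exists2 q, q \in C & forall q', q' \in C -> v q' <= v q.
  by apply: compact_EVT_max => //; exists p.
have {}vmax q' : C q' -> v q' <= v q by move=> ?; apply: vmax; rewrite inE.
apply: le_trans (vmax _ Cp) _.
have [[Mq qs] rq] := Cq; rewrite /= in qs rq.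
have uq0 : 0 <= d * u q by rewrite mulr_ge0 ?(ltW d0) ?u_ge0.
have vf : v q <= f q by rewrite /v mulNr lerBlDr lerDl.
have [Bq|Bq] := pselect (B q); first by rewrite (le_trans vf)// f_bdry.
have [Nr|Nr] := leP (N q) r; first by rewrite (le_trans vf)// fm.
have [sN|sN] := leP s' (N q).
  have : k / d <= u q by apply: us => //; apply: le_trans sN; rewrite le_max lexx.
  rewrite ler_pdivrMr// mulrC => kd; apply: le_trans m0.
  by rewrite /v mulNr subr_le0 (le_trans (f_le Mq)).
(* Otherwise [q] is a local maximum of the strictly subharmonic [v]. *)
exfalso.
have oMB := interior_open.
have nMB : \forall q' \near q, (M `\` B) q' by apply: open_nbhs_nbhs.
have Nq : {for q, continuous N}.
  have := continuous_subspaceW (@subDsetl _ M B) N_cont.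
  by rewrite continuous_open_subspace//; apply; rewrite inE.
have near_r : \forall q' \near q, r < N q'.
  by apply: (Nq [set x | r < x]); apply: open_nbhs_nbhs; split=> //; exact: open_gt.
have near_s : \forall q' \near q, N q' < s'.
  by apply: (Nq [set x | x < s']); apply: open_nbhs_nbhs; split=> //; exact: open_lt.
have nearv : \forall q' \near q, v q' <= v q.
  near=> q'; apply: vmax; split; [split|].
  - by have [] : (M `\` B) q' by near: q'.
  - by apply: ltW; near: q'.
  - by apply: ltW; near: q'.
have [c [l [Sc cq l0 lu]]] := u_super (conj Mq Bq) Nr.
have [_ lf] := f_harm Sc (local_set_uncplx cq (conj Mq Bq)).
have lv := has_laplacianD lf (has_laplacianZ (- d) lu).
have := has_laplacian_le0 lv (local_max_chart cq nearv).
by rewrite add0r mulNr oppr_le0 leNgt pmulr_rlt0// l0.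
Unshelve. all: by end_near. Qed.

(** The set where [f] takes a positive maximum would be open and closed in [M]. *)
Lemma harmonic_le0 : B !=set0 -> forall p, M p -> f p <= 0.
Proof.
move=> [b Bb] p0 Mp0; rewrite leNgt; apply/negP => fp0.
pose K := M `&` [set p | N p <= r].
have K0 : K !=set0.
  apply/set0P/eqP => KE; move: fp0; apply/negP; rewrite -leNgt.
  by apply: maximum_at_infinity => // q Mq Nq; have : K q by []; rewrite KE.
have [q /set_mem[Mq Nq] fmax] : exists2 q, q \in K & forall q', q' \in K -> f q' <= f q.
  apply: compact_EVT_max => //; first exact: N_compact.
  by apply: continuous_subspaceW f_cont; exact: subIsetl.
have {}fmax q' : M q' -> N q' <= r -> f q' <= f q.
  by move=> ? ?; apply: fmax; rewrite inE.
have [fq|fq] := leP (f q) 0.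
  move: fp0; apply/negP; rewrite -leNgt; apply: maximum_at_infinity => // q' Mq' Nq'.
  exact: le_trans (fmax _ Mq' Nq') fq.
have fm q' : M q' -> f q' <= f q.
  by apply: maximum_at_infinity => //; exact: ltW.
pose A := M `&` [set p | f p = f q].
have AE : A = M.
  apply: (bordered_connected MB); first by exists q.
  - exists (A°); first exact: open_interior.
    apply/seteqP; split=> p; last by move=> [_ /interior_subset].
    move=> [Mp fp]; split=> //.
    have Bp : ~ B p by move=> /f_bdry E; move: fq; rewrite -fp E ltxx.
    have nf : \forall q' \near p, f q' = f q.
      apply: (strong_maximum interior_open f_harm _ _ fp) => //.
      by move=> q' [Mq' _]; exact: fm.
    have nM : \forall q' \near p, (M `\` B) q'.
      by apply: open_nbhs_nbhs; split=> //; exact: interior_open.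
    by apply: filterS2 nf nM => q' ? [].
  - have cf : continuous (f : subspace M -> R) by exact: f_cont.
    have /closed_subspaceP[V cV VE] := (continuous_closedP _).1 cf _ (@closed_eq R (f q)).
    by exists V => //; rewrite setIC VE setIC.
have : A b by rewrite AE; exact: (bordered_sub MB).
by move=> [_ /=]; rewrite f_bdry// => E; move: fq; rewrite -E ltxx.
Qed.

End Exhaustion.

(** A surface with an exhaustion and a function which, near infinity, is
    strictly superharmonic, nonnegative and proper is relative parabolic. *)
Lemma relative_parabolic_of_superharmonic (N u : T -> R) (r : R) :
  {within M, continuous N} ->
  (forall s, compact (M `&` [set p | N p <= s])) ->
  {within M `&` [set p | r <= N p], continuous u} ->
  (forall p, M p -> r <= N p -> 0 <= u p) ->
  (forall k, exists s, forall p, M p -> s <= N p -> k <= u p) ->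
  (forall p, (M `\` B) p -> r < N p ->
     exists c l, [/\ atlas S c, dom c p, l < 0 &
                     has_laplacian (local c u) (uncplx (c p)) l]) ->
  B !=set0 -> relative_parabolic S M B.
Proof.
move=> cN kN cu u0 uy us B0 f cf hf [k fk] fB p Mp.
have harm c : atlas S c -> forall w, local_set c (M `\` B) w ->
    {for w, continuous (local c f)} /\ has_laplacian (local c f) w 0.
  move=> Sc w Aw; have [C2 lap] := hf c Sc.
  have oA := open_local_set (c := c) interior_open.
  split; first by case: C2 => cw _; exact: cw.
  by rewrite -(lap w Aw); exact: has_laplacian_Ck2 C2.
apply/eqP; rewrite eq_le; apply/andP; split.
  apply: (harmonic_le0 cN kN cu u0 uy us cf harm _ fB B0 Mp) => q Mq.
  exact: le_trans (ler_norm _) (fk q Mq).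
(* The same bound for [- f], written as a multiple of [f]. *)
rewrite -oppr_le0 -mulN1r.
apply: (@harmonic_le0 N u r cN kN cu u0 uy us (fun q => -1 * f q) k _ _ _ _ B0 p Mp).
- by move=> q; apply: cvgM; [exact: cvg_cst|exact: cf].
- move=> c Sc w Aw; have [cw lw] := harm c Sc w Aw; split.
    by apply: cvgM; [exact: cvg_cst|exact: cw].
  by rewrite -[0](mulr0 (-1)); exact: has_laplacianZ.
- by move=> q Mq; rewrite mulN1r; apply: le_trans (ler_norm _) _; rewrite normrN fk.
- by move=> q /fB ->; rewrite mulr0.
Qed.

End Bordered.

(** * The cone and the logarithm of the Lorentzian square *)

Section Cone.
Variable R : realType.
Implicit Types v : 'rV[R]_3.

(** The square of the Euclidean norm. *)
Definition euclid v : R := x1 v ^+ 2 + x2 v ^+ 2 + x3 v ^+ 2.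

Lemma continuous_coordinates :
  [/\ continuous (@x1 R), continuous (@x2 R) & continuous (@x3 R)].
Proof. by split; exact: coord_continuous. Qed.

Lemma continuous_euclid : continuous euclid.
Proof.
have [c1 c2 c3] := continuous_coordinates; move=> v.
exact: (cvgD (cvgD (cvgM (c1 v) (c1 v)) (cvgM (c2 v) (c2 v)))
             (cvgM (c3 v) (c3 v))).
Qed.

Lemma continuous_lorentz_square : continuous (fun v => lorentz v v).
Proof.
have [c1 c2 c3] := continuous_coordinates; move=> v.
exact: (cvgB (cvgD (cvgM (c1 v) (c1 v)) (cvgM (c2 v) (c2 v)))
             (cvgM (c3 v) (c3 v))).
Qed.

Lemma compact_euclid_ball (s : R) : compact [set v | euclid v <= s].
Proof.
apply: bounded_closed_compact; last first.
  exact: ((continuous_closedP _).1 continuous_euclid _ (@closed_le R s)).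
have sq (x : R) : x ^+ 2 <= s -> `|x| <= s + 1.
  move=> xs; have := sqr_ge0 (`|x| - 1); have := real_normK (num_real x).
  by have := normr_ge0 x; nra.
exists (s + 1); split; first exact: num_real.
move=> k sk v /= vs; apply: le_trans (ltW sk).
have {}vs : forall i, `|v ord0 i| <= s + 1.
  have := sqr_ge0 (x1 v); have := sqr_ge0 (x2 v); have := sqr_ge0 (x3 v).
  rewrite /euclid /x1 /x2 /x3 in vs * => p3 p2 p1 i.
  have [->|[->|->]] : i = 0 \/ i = 1 \/ i = 2.
    by case: i => -[|[|[|//]]] ?; [left|right; left|right; right]; exact: val_inj.
  - by apply: sq; lra.
  - by apply: sq; lra.
  - by apply: sq; lra.
rewrite [leLHS]/Num.Def.normr /= mx_normrE; apply: bigmax_le.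
  by apply: le_trans (vs 0); exact: normr_ge0.
by move=> [i j] _ /=; rewrite ord1.
Qed.

Lemma tan_lt1 (alpha : R) : 0 < alpha -> alpha < pi / 4 -> 0 <= tan alpha < 1.
Proof.
move=> a0 a4; have p0 := pi_gt0 R.
have I (x : R) : 0 <= x -> x <= pi / 4 -> x \in `](- (pi / 2)), (pi / 2)[.
  by move=> x0 x4; rewrite in_itv /=; apply/andP; split; lra.
apply/andP; split; last by rewrite -tan_piquarter ltr_tan ?I//; lra.
by rewrite -tan0 ltW// ltr_tan ?I//; lra.
Qed.

(** In the cone the Lorentzian square dominates the Euclidean one. *)
Lemma cone_lorentz (alpha : R) : 0 < alpha -> alpha < pi / 4 ->
  exists2 k, 0 < k & forall v, cone alpha v -> k * euclid v <= lorentz v v.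
Proof.
move=> a0 a4; have /andP[t0 t1] := tan_lt1 a0 a4.
rewrite /cone; move: (tan alpha) t0 t1 => t t0 t1.
have n0 : 0 < 1 + t ^+ 2 by rewrite ltr_pwDl// sqr_ge0.
have t2 : t ^+ 2 < 1 by rewrite expr_lt1.
exists ((1 - t ^+ 2) / (1 + t ^+ 2)); first by rewrite divr_gt0// subr_gt0.
move=> v /= vc; pose sigma := x1 v ^+ 2 + x2 v ^+ 2.
have s0 : 0 <= sigma by rewrite addr_ge0 ?sqr_ge0.
have z2 : x3 v ^+ 2 <= sigma * t ^+ 2.
  rewrite -(real_normK (num_real (x3 v))) -(sqr_sqrtr s0) -exprMn.
  by rewrite lerXn2r// nnegrE mulr_ge0// sqrtr_ge0.
rewrite mulrAC ler_pdivrMr// /euclid /lorentz -!expr2 -/sigma.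
by move: (x3 v ^+ 2) z2 t2 n0 => y; move: (t ^+ 2) => w *; nra.
Qed.

End Cone.

(** The function [ln (<X, X> - 1)] is strictly superharmonic in some chart around
    each interior point where it is defined. *)
Lemma maximal_ln_superharmonic (R : realType) (T : topologicalType)
    (S : riemann_surface R T) (M B : set T) (X : T -> 'rV[R]_3) p :
  bordered S M B -> conformal_maximal_immersion S M B X -> (M `\` B) p ->
  1 < lorentz (X p) (X p) ->
  exists c l, [/\ atlas S c, dom c p, l < 0 &
    has_laplacian (local c (fun q => ln (lorentz (X q) (X q) - 1)))
      (uncplx (c p)) l].
Proof.
move=> MB [[Y [sY cY XY]] spX hX] Op X1.
have [c Sc cp] := atlas_cover S p; have [Mp Bp] := Op.
set w0 := uncplx (c p).
have Aw0 : local_set c (M `\` B) w0 by exact: local_set_uncplx.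
have oA : open (local_set c (M `\` B)) by apply/open_local_set/(interior_open MB).
have XYw : \forall w \near w0, local c X w = local c Y w.
  have : nbhs w0 (local_set c (M `\` B)) by apply: open_nbhs_nbhs.
  apply: filterS => w /local_setE[q [cq [Mq _]] ->].
  by rewrite !local_uncplx// XY.
have [l l0 lY] : exists2 l, l < 0 & has_laplacian
    (fun w => ln (lorentz (local c Y w) (local c Y w) - 1)) w0 l.
  apply: (@ln_lorentz_superharmonic _ (local_set c setT)).
  - by apply: open_local_set; exact: openT.
  - exact: local_set_uncplx.
  - exact: sY.
  - by move=> w; exact: cY.
  - by apply: near_eq_spacelike_at XYw _; exact: spX.
  - by rewrite -(near_eq_mean_curvature XYw); exact: hX.
  - by rewrite local_uncplx// -XY.
exists c, l; split=> //; apply: near_eq_has_laplacian lY.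
apply: filterS XYw => w XYw; rewrite -XYw.
exact: erefl.
Qed.

Theorem corollary3p1 (R : realType) (T : topologicalType)
    (S : riemann_surface R T) (openS : open_surface T)
    (M B : set T) (MB : bordered S M B) (B0 : B !=set0)
    (X : T -> 'rV[R]_3)
    (maxX : conformal_maximal_immersion S M B X)
    (wX : weierstrass_data_extend S M B X)
    (propX : proper_on M X)
    (alpha : R) (alpha_gt0 : 0 < alpha) (alpha_lt : alpha < pi / 4)
    (evX : eventually_in M X (cone alpha)) :
  relative_parabolic S M B.
Proof.
have [[Y [sY _ XY]] _ _] := maxX.
have Xc : {within M, continuous X}.
  apply: (@subspace_eq_continuous _ _ _ Y).
    by move=> p /set_mem Mp; exact/esym/XY.
  by apply: continuous_subspaceT; exact: (smooth_continuous sY).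
pose N p := euclid (X p); pose rho p := lorentz (X p) (X p).
have cN : {within M, continuous N}.
  by move=> p; apply: (continuous_comp (Xc p)); exact: continuous_euclid.
have cr : {within M, continuous rho}.
  move=> p; apply: (@continuous_comp _ _ _ (X : subspace M -> _)
    (fun v => lorentz v v) p (Xc p)).
  exact: continuous_lorentz_square.
have [k k0 kX] := cone_lorentz alpha_gt0 alpha_lt.
have [K [cK KM KX]] := evX.
have [r0 Kr0] : exists r0, forall p, K p -> N p <= r0.
  have [->|/set0P K0] := eqVneq K set0; first by exists 0.
  have [q _ qmax] := compact_EVT_max K0 cK (continuous_subspaceW KM cN).
  by exists (N q) => p Kp; apply: qmax; rewrite inE.
(* Where [r <= N], the point is outside [K] and [rho] is at least [2]. *)
pose r := Num.max (r0 + 1) (2 / k).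
have rN p : M p -> r <= N p -> k * N p <= rho p.
  rewrite ge_max => Mp /andP[rp _]; apply: kX; apply: KX; split=> // Kp.
  by have := le_trans rp (Kr0 p Kp); rewrite gerDl ler10.
have r2 p : M p -> r <= N p -> 2 <= rho p.
  move=> Mp rp; apply: le_trans (rN p Mp rp).
  by move: rp; rewrite ge_max => /andP[_]; rewrite ler_pdivrMr// mulrC.
apply: (@relative_parabolic_of_superharmonic _ _ _ _ _ MB N
  (fun p => ln (rho p - 1)) r cN) => //.
- by move=> s; apply: (propX [set v | euclid v <= s]); exact: compact_euclid_ball.
- have sub : M `&` [set p | r <= N p] `<=` M by exact: subIsetl.
  have crs := continuous_subspaceW sub cr.
  apply/subspace_continuousP => p [Mp rp].
  have /subspace_continuousP/(_ p (conj Mp rp)) crp := crs.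
  apply: (@cvg_comp _ _ _ (fun p => rho p - 1) (@ln R) _ (nbhs (rho p - 1))).
    by apply: cvgB; [exact: crp|exact: cvg_cst].
  by apply: continuous_ln; have := r2 p Mp rp; lra.
- by move=> p Mp rp; apply: ln_ge0; have := r2 p Mp rp; lra.
- move=> x; exists (Num.max r ((1 + expR x) / k)) => p Mp.
  rewrite ge_max => /andP[rp xp].
  have xr : expR x <= rho p - 1.
    have := rN p Mp rp; move: xp; rewrite ler_pdivrMr// mulrC; lra.
  rewrite -[x]expRK ler_ln ?posrE ?expR_gt0//.
  exact: lt_le_trans (expR_gt0 x) xr.
- move=> p Op rp; apply: (maximal_ln_superharmonic MB maxX Op).
  by have := r2 p Op.1 (ltW rp); rewrite /rho; lra.
Qed.
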